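(* Let $g:\mathcal{H}\to\mathbb{R}$ be a non-negative strongly convex function of class $C^1$ and let $\theta\in(0,\tfrac12]$. Then there exists $\kappa>0$ such that the convex function $h(x):=(g(x))^{\frac{1}{2\theta}}$ satisfies $$\big(h(x)-h_Q^*\big)^{\theta}\ \ge\ \kappa\,\mathrm{dist}\big(x,\arg\min_Q h\big)\qquad\text{for all } x\in Q.$$
   Context: $\mathcal{H}$ is a real Hilbert space with norm $\|\cdot\|$, and $Q$ is a closed, convex, non-empty subset of $\mathcal{H}$. For a function $h$ attaining its minimum over $Q$, $h_Q^*:=\min_Q h$ and $\arg\min_Q h:=\{x\in Q: h(x)=h_Q^*\}$; $\mathrm{dist}(x,S)=\inf_{y\in S}\|x-y\|$. *)

(* Defs.v *)
From HB Require Import structures.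
From mathcomp Require Import all_boot all_order all_algebra.
From mathcomp Require Import all_classical all_reals all_analysis.
From mathcomp Require Import sesquilinear.
Set Implicit Arguments.
Unset Strict Implicit.
Unset Printing Implicit Defensive.
Import Order.TTheory GRing.Theory Num.Theory.
Import numFieldNormedType.Exports.
Local Open Scope classical_set_scope.
Local Open Scope ring_scope.

(* A complete normed module equipped with a dot product [ip] satisfying
   [induces_norm ip] is a real Hilbert space. *)
Definition induces_norm (R : realType) (H : normedModType R)
    (ip : {dot H for (idfun : R -> R)}) : Prop :=
  forall x : H, `|x| = Num.sqrt (ip x x).

Definition strongly_convex (R : realType) (H : normedModType R)
    (g : H -> R) : Prop :=
  exists2 mu : R, 0 < mu &
    forall (x y : H) (t : R), 0 <= t <= 1 ->
      g (t *: x + (1 - t) *: y) <=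
        t * g x + (1 - t) * g y - mu / 2 * (t * (1 - t)) * `|x - y| ^+ 2.

(* Fréchet differentiable everywhere, with a differential that is continuous
   for the operator norm: the last bound says that the operator norm of
   ['d g y - 'd g x] is at most [e]. *)
Definition class_C1 (R : realType) (H : normedModType R)
    (g : H -> R^o) : Prop :=
  (forall x : H, differentiable g x) /\
  (forall (x : H) (e : R), 0 < e ->
    \forall y \near x, forall v : H,
      `|'d g y v - 'd g x v| <= e * `|v|).

Section minimization.
Context {R : realType} {T : Type}.
Implicit Types (Q : set T) (h : T -> R).

(* Contains at most one element: the least value of [h] over [Q], if any. *)
Definition least_values Q h : set R := (h @` Q) `&` lbound (h @` Q).

Definition attains_min Q h : Prop := least_values Q h !=set0.

(* Arbitrary when the minimum is not attained. *)
Definition min_over Q h : R := get (least_values Q h).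

Definition argmin Q h : set T := [set x | Q x /\ h x = min_over Q h].

End minimization.

(* [inf] takes the default value 0 on the empty set. *)
Definition dist (R : realType) (H : normedModType R) (x : H) (S : set H) : R :=
  inf [set `|x - y| | y in S].

(* Main.v *)
(* On [Q], a midpoint of two points has value at least the infimum [m] of [g],
   so strong convexity gives [mu / 4 * |x - y|^2 <= (g x - m) + (g y - m)].
   Hence minimizing sequences are Cauchy and converge to a minimizer [z], and
   [y := z] is the quadratic growth bound [mu / 4 * |x - z|^2 <= g x - g z].
   With [p := 1 / (2 * theta) >= 1], superadditivity of [t ^ p] gives
   [(g x - g z) ^ p <= h x - h z], and raising to [theta] leaves the exponent
   [p * theta = 1 / 2]. *)
Require Import Defs.
From HB Require Import structures.
From mathcomp Require Import all_boot all_order all_algebra.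
From mathcomp Require Import all_classical all_reals all_analysis.
From mathcomp Require Import sesquilinear.
From mathcomp Require Import ring lra.
Import Order.TTheory GRing.Theory Num.Theory.
Import numFieldNormedType.Exports.
Local Open Scope classical_set_scope.
Local Open Scope ring_scope.

(** Each of [a] and [b] is a share [r * (a + b)] of the sum with [0 <= r <= 1]. Since [1 <= p] gives
    [r ^ p <= r], its power is at most [r * (a + b) ^ p], and the two shares add up to 1. *)
Lemma powR_superadditive {R : realType} {p a b : R} :
  1 <= p -> 0 <= a -> 0 <= b -> a `^ p + b `^ p <= (a + b) `^ p.
Proof.
move=> p1 a0 b0.
(* As [0 ^ 0 = 1], the degenerate cases need a nonzero exponent. *)
have p0 : p != 0 by rewrite gt_eqF// (lt_le_trans ltr01 p1).
have [s0|s0] := eqVneq (a + b) 0.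
  move/eqP: s0; rewrite paddr_eq0// => /andP[/eqP-> /eqP->].
  by rewrite addr0 powR0// addr0.
have sgt0 : 0 < a + b by rewrite lt0r s0 addr_ge0.
have le_share c : 0 <= c -> c <= a + b -> c `^ p <= c / (a + b) * (a + b) `^ p.
  rewrite le0r => /predU1P[->|c0] cs; first by rewrite powR0// !mul0r.
  rewrite -[in leLHS](@divfK _ (a + b) s0 c).
  apply: ge1r_powRZ => //; last exact: ltW.
  by rewrite divr_gt0//= ler_pdivrMr// mul1r.
apply: (le_trans (lerD (le_share a a0 _) (le_share b b0 _))).
- by rewrite lerDl.
- by rewrite lerDr.
- by rewrite -mulrDl -mulrDl divff// mul1r.
Qed.

Lemma convex_function_powR {R : realType} {E : lmodType R} {g : E -> R} {p : R} :
  1 <= p -> (forall x, 0 <= g x) -> convex_function [set: E] g ->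
  convex_function [set: E] (fun x => g x `^ p).
Proof.
move=> p1 g0 gconv t x y xE yE.
have pos u : g u \in `[0, +oo[%classic by rewrite inE/= in_itv/= g0.
have := convex_powR p1 t (pos x) (pos y); apply: le_trans.
have p0 : 0 <= p := le_trans ler01 p1.
apply: ge0_ler_powR (gconv t x y xE yE) => //; rewrite nnegrE//.
exact: le_trans (g0 _) (gconv t x y xE yE).
Qed.

Lemma strongly_convex_convex {R : realType} {H : normedModType R} {g : H -> R} :
  strongly_convex g -> convex_function [set: H] g.
Proof.
move=> [mu mu0 gsc] t x y _ _.
have t01 : 0 <= t%:num <= 1 by apply/andP.
apply: le_trans (gsc x y t%:num t01) _.
rewrite gerBl; have /andP[t0 t1] := t01.
by rewrite !mulr_ge0 ?exprn_ge0 ?subr_ge0// ltW.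
Qed.

(** The lower bound [m] is left free, with [c] independent of it: the infimum yields Cauchy
    sequences, the attained minimum yields quadratic growth. *)
Lemma strongly_convex_midpoint {R : realType} {H : normedModType R}
    {Q : set H} {g : H -> R} : convex_set Q -> strongly_convex g ->
  exists2 c : R, 0 < c & forall m : R, lbound (g @` Q) m ->
    forall x y, Q x -> Q y -> c * `|x - y| ^+ 2 <= (g x - m) + (g y - m).
Proof.
move=> Qconv [mu mu0 gsc]; exists (mu / 4) => [|m mlb x y Qx Qy].
  by rewrite divr_gt0.
have h01 : 0 <= (2^-1 : R) <= 1 by apply/andP; split; lra.
have Qmid : Q (2^-1 *: x + (1 - 2^-1) *: y).
  have /andP[h0 h1] := h01.
  by have := Qconv x y (Itv01 h0 h1) (mem_set Qx) (mem_set Qy) => /set_mem.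
have := mlb _ (imageP g Qmid); have := gsc x y _ h01.
lra.
Qed.

Lemma strongly_convex_argmin {R : realType} {H : completeNormedModType R}
    {Q : set H} {g : H -> R} :
  closed Q -> convex_set Q -> Q !=set0 -> has_lbound (g @` Q) ->
  strongly_convex g -> continuous g ->
  exists2 z, Q z & lbound (g @` Q) (g z).
Proof.
move=> Qclosed Qconv [q Qq] glb gsc gcont.
have ginf : has_inf (g @` Q) by split=> //; exists (g q); exact: imageP.
pose m := inf (g @` Q).
have mlb : lbound (g @` Q) m by exact: ge_inf.
have [c c0 midc] := strongly_convex_midpoint Qconv gsc.
have uex (n : nat) : exists x, Q x /\ g x < m + n.+1%:R^-1.
  have n0 : 0 < n.+1%:R^-1 :> R by rewrite invr_gt0.
  by have [_ [x Qx <-] gx] := inf_adherent n0 ginf; exists x.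
have {uex} [u uP] := choice uex.
have u_cvg : cvgn u.
  apply: cauchy_cvg; apply: cauchy_exP => e e0.
  (* From rank [k] on, both excesses over [m] are below [1 / (k + 1) < c * e ^ 2 / 2], so their sum
     stays below [c * e ^ 2] and the tail lies in the ball of radius [e] about [u k]. *)
  have ce0 : 0 < c * e ^+ 2 / 2 by rewrite divr_gt0// mulr_gt0// exprn_gt0.
  have [k] := ltr_add_invr ce0; rewrite add0r => kP.
  exists (u k); exists k => // n /= kn.
  rewrite -ball_normE/= -(@ltr_pXn2r _ 2)// ?nnegrE//; last exact: ltW.
  rewrite -(ltr_pM2l c0).
  have nk : n.+1%:R^-1 <= k.+1%:R^-1 :> R by rewrite lef_pV2 ?posrE// ler_nat.
  have [Qk gk] := uP k; have [Qn gn] := uP n.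
  have := midc m mlb _ _ Qk Qn.
  move: kP nk gk gn; move: (k.+1%:R^-1) (n.+1%:R^-1) => a b; lra.
pose z : H := limn u.
have Qz : Q z.
  by apply: (closed_cvg Q Qclosed _ z u_cvg); apply: nearW => n; exact: (uP n).1.
have gu_cvg : g (u n) @[n --> \oo] --> g z by exact: cvg_comp u_cvg (gcont z).
(* It suffices that [g z <= m], the limit of [g (u n) < m + 1 / (n + 1)]. *)
exists z => // _ [x Qx <-]; apply: le_trans (mlb _ (imageP g Qx)).
have m_cvg : m + n.+1%:R^-1 @[n --> \oo] --> m.
  by rewrite -[X in _ --> X]addr0; apply: cvgD; [exact: cvg_cst|exact: cvg_harmonic].
apply: (ler_cvg_to gu_cvg m_cvg).
by apply: nearW => n; apply: ltW; exact: (uP n).2.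
Qed.

(** Two least values bound each other, so the choice made by [get] is forced. *)
Lemma min_over_eq {R : realType} {T : Type} {Q : set T} {h : T -> R} {z : T} :
  Q z -> lbound (h @` Q) (h z) -> min_over Q h = h z.
Proof.
move=> Qz zlb; rewrite /min_over.
have [|[x Qx <-] xlb] := @getPex _ (least_values Q h).
  by exists (h z); split=> //; exact: imageP.
by apply: le_anti; rewrite xlb ?zlb//; exact: imageP.
Qed.

Lemma dist_le {R : realType} {H : normedModType R} {S : set H} (x : H) {z : H} :
  S z -> dist x S <= `|x - z|.
Proof.
move=> Sz; apply: ge_inf; last by exists z.
by exists 0 => _ [y _ <-].
Qed.

Theorem proposition1p1 (R : realType) (H : completeNormedModType R)
    (ip : {dot H for (idfun : R -> R)}) (hip : induces_norm ip)
    (Q : set H) (Qclosed : closed Q) (Qconvex : convex_set Q)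
    (Qneq0 : Q !=set0)
    (g : H -> R) (g_ge0 : forall x : H, 0 <= g x)
    (g_sconvex : strongly_convex g) (g_C1 : class_C1 g)
    (theta : R) (theta_gt0 : 0 < theta) (theta_le : theta <= 1 / 2) :
  let h := fun x : H => g x `^ (1 / (2 * theta)) in
  [/\ convex_function [set: H] h,
      attains_min Q h &
      exists2 kappa : R, 0 < kappa &
        forall x : H, Q x ->
          kappa * dist x (argmin Q h) <= (h x - min_over Q h) `^ theta].
Proof.
set p := 1 / (2 * theta) => h.
have p1 : 1 <= p by rewrite ler_pdivlMr ?mulr_gt0// mul1r; lra.
have ptheta : p * theta = 2^-1 by rewrite /p; field; exact: lt0r_neq0.
have gcont : continuous g.
  by move=> x; exact: (differentiable_continuous (g_C1.1 x)).
have glb : has_lbound (g @` Q) by exists 0 => _ [y _ <-].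
have [z Qz zlb] :=
  strongly_convex_argmin Qclosed Qconvex Qneq0 glb g_sconvex gcont.
have hzlb : lbound (h @` Q) (h z).
  move=> _ [x Qx <-]; apply: ge0_ler_powR; rewrite ?nnegrE//; first lra.
  by apply: zlb; exact: imageP.
have hmin := min_over_eq Qz hzlb.
split.
- exact/convex_function_powR/strongly_convex_convex.
- by exists (h z); split=> //; exact: imageP.
have [c c0 midc] := strongly_convex_midpoint Qconvex g_sconvex.
(* This constant is what the square root of [growth] produces. *)
exists (Num.sqrt c) => [|x Qx]; first by rewrite sqrtr_gt0.
have growth : c * `|x - z| ^+ 2 <= g x - g z.
  by have := midc _ zlb _ _ Qx Qz; rewrite subrr addr0.
have gxz : 0 <= g x - g z.
  by apply: le_trans growth; rewrite mulr_ge0 ?exprn_ge0// ltW.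
(* Superadditivity is applied to the splitting [g x = (g x - g z) + g z]. *)
have growth_h : (g x - g z) `^ p <= h x - h z.
  have := powR_superadditive p1 gxz (g_ge0 z); rewrite subrK /h; lra.
(* By [ptheta], this square root is [((g x - g z) ^ p) ^ theta], to which [growth_h] applies. *)
rewrite hmin; apply: (@le_trans _ _ (Num.sqrt (g x - g z))); last first.
  rewrite -powR12_sqrt// -ptheta powRrM.
  apply: ge0_ler_powR (growth_h); rewrite ?nnegrE ?powR_ge0//; first exact: ltW.
  exact: le_trans (powR_ge0 _ _) growth_h.
(* The point [z] lies in [argmin Q h], so [|x - z|] bounds the distance from above. *)
apply: (@le_trans _ _ (Num.sqrt c * `|x - z|)).
  by rewrite ler_wpM2l ?sqrtr_ge0//; apply: dist_le; split.
rewrite -[X in _ * X]ger0_norm// -sqrtr_sqr -sqrtrM; last exact: ltW.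
exact: ler_wsqrtr.
Qed.
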